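(* Every non-trivial $3$-braid admits a $\sigma$-positive or a $\sigma$-negative expression; that is, every $x\in B_3$ with $x\neq1$ is represented by a $\sigma$-positive word or by a $\sigma$-negative word in the letters $\sigma_1^{\pm1},\sigma_2^{\pm1}$.
   Context: $B_3=\langle\sigma_1,\sigma_2;\ \sigma_1\sigma_2\sigma_1=\sigma_2\sigma_1\sigma_2\rangle$ is the $3$-strand braid group. The main generator of a nonempty word in $\sigma_1^{\pm1},\sigma_2^{\pm1}$ is $\sigma_m$ where $m$ is the largest index such that $\sigma_m$ or $\sigma_m^{-1}$ occurs. The word is $\sigma$-positive (resp. $\sigma$-negative) if its main generator occurs only positively, i.e. $\sigma_m$ occurs but $\sigma_m^{-1}$ does not (resp. only negatively, i.e. $\sigma_m^{-1}$ occurs but $\sigma_m$ does not). *)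

(* Defs.v *)
From HB Require Import structures.
From mathcomp Require Import all_boot.
From mathcomp Require Import boolp.

Set Implicit Arguments.
Unset Strict Implicit.
Unset Printing Implicit Defensive.

Local Open Scope quotient_scope.

(* Generators are indexed from 0: the letter (i, true) is sigma_(i+1) and
   (i, false) is its inverse. *)
Definition letter : Type := ('I_2 * bool)%type.
Definition word : Type := seq letter.


Definition s1 : 'I_2 := ord0.
Definition s2 : 'I_2 := ord_max.

Definition letter_inv (l : letter) : letter := (l.1, ~~ l.2).
Definition word_inv (w : word) : word := rev (map letter_inv w).

(* The congruence on words defining B_3: it is generated by free cancellation
   and by the relation sigma_1 sigma_2 sigma_1 = sigma_2 sigma_1 sigma_2. *)
Inductive braid_equiv : word -> word -> Prop :=
| BraidRefl w : braid_equiv w w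
| BraidSym v w : braid_equiv v w -> braid_equiv w v
| BraidTrans u v w : braid_equiv u v -> braid_equiv v w -> braid_equiv u w
| BraidCat v v' w w' :
    braid_equiv v v' -> braid_equiv w w' -> braid_equiv (v ++ w) (v' ++ w')
| BraidCancel l : braid_equiv [:: l; letter_inv l] [::]
| BraidRel : braid_equiv [:: (s1, true); (s2, true); (s1, true)]
                         [:: (s2, true); (s1, true); (s2, true)].

Definition braid_rel (v w : word) : bool := `[< braid_equiv v w >].

Lemma braid_rel_refl : reflexive braid_rel.
Proof. by move=> w; apply/asboolP/BraidRefl. Qed.

Lemma braid_rel_sym : symmetric braid_rel.
Proof. by move=> v w; apply/asboolP/asboolP => /BraidSym. Qed.

Lemma braid_rel_trans : transitive braid_rel.
Proof.
move=> v u w /asboolP uv /asboolP vw; apply/asboolP.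
exact: BraidTrans uv vw.
Qed.

Canonical braid_rel_equiv :=
  EquivRel braid_rel braid_rel_refl braid_rel_sym braid_rel_trans.

Definition B3 : Type := {eq_quot braid_rel}.
HB.instance Definition _ := EqQuotient.on B3.
HB.instance Definition _ := Choice.on B3.

Definition B3_of (w : word) : B3 := \pi_B3 w.

Lemma B3_ofP (v w : word) : B3_of v = B3_of w <-> braid_equiv v w.
Proof.
split; first by move/eqmodP/asboolP.
by move=> vw; apply/eqmodP/asboolP.
Qed.

Lemma repr_B3_of (w : word) : braid_equiv (repr (B3_of w)) w.
Proof. by apply/B3_ofP; rewrite /B3_of reprK. Qed.

Lemma letter_invK : involutive letter_inv.
Proof. by case=> i b; rewrite /letter_inv /= negbK. Qed.

Lemma word_inv_cat v w : word_inv (v ++ w) = word_inv w ++ word_inv v.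
Proof. by rewrite /word_inv map_cat rev_cat. Qed.

Lemma word_invK : involutive word_inv.
Proof.
by move=> w; rewrite /word_inv map_rev revK (mapK letter_invK).
Qed.

Lemma word_mulV w : braid_equiv (w ++ word_inv w) [::].
Proof.
elim: w => [|l w IHw]; first exact: BraidRefl.
rewrite -cat1s word_inv_cat -catA (catA w).
apply: BraidTrans (BraidCancel l).
apply: BraidCat (BraidRefl _) _.
by rewrite -[X in braid_equiv _ X]cat0s; apply: BraidCat IHw (BraidRefl _).
Qed.

Lemma word_Vmul w : braid_equiv (word_inv w ++ w) [::].
Proof. by have := word_mulV (word_inv w); rewrite word_invK. Qed.

Lemma word_inv_equiv v w :
  braid_equiv v w -> braid_equiv (word_inv v) (word_inv w).
Proof.
move=> vw; have e1 : braid_equiv (word_inv v ++ (w ++ word_inv w)) (word_inv v).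
  rewrite -[X in braid_equiv _ X]cats0.
  exact: BraidCat (BraidRefl _) (word_mulV w).
apply: BraidTrans (BraidSym e1) _; rewrite catA.
rewrite -[X in braid_equiv _ X]cat0s; apply: BraidCat (BraidRefl _).
apply: BraidTrans (word_Vmul v).
exact: BraidCat (BraidRefl _) (BraidSym vw).
Qed.

Definition B3_mul (x y : B3) : B3 := B3_of (repr x ++ repr y).
Definition B3_one : B3 := B3_of [::].
Definition B3_inv (x : B3) : B3 := B3_of (word_inv (repr x)).

Lemma B3_mulE v w : B3_mul (B3_of v) (B3_of w) = B3_of (v ++ w).
Proof. by apply/B3_ofP; apply: BraidCat; apply: repr_B3_of. Qed.

Lemma B3_invE w : B3_inv (B3_of w) = B3_of (word_inv w).
Proof. by apply/B3_ofP; apply/word_inv_equiv/repr_B3_of. Qed.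

Lemma B3_ofW (x : B3) : B3_of (repr x) = x.
Proof. exact: reprK. Qed.

Lemma B3_mulA : associative B3_mul.
Proof.
move=> x y z; rewrite -(B3_ofW x) -(B3_ofW y) -(B3_ofW z).
by rewrite !B3_mulE catA.
Qed.

Lemma B3_mul1 : left_id B3_one B3_mul.
Proof. by move=> x; rewrite -(B3_ofW x) B3_mulE. Qed.

Lemma B3_mulr1 : right_id B3_one B3_mul.
Proof. by move=> x; rewrite -(B3_ofW x) B3_mulE cats0. Qed.

Lemma B3_mulV : left_inverse B3_one B3_inv B3_mul.
Proof.
move=> x; rewrite -(B3_ofW x) B3_invE B3_mulE.
by apply/B3_ofP/word_Vmul.
Qed.

Lemma B3_mulrV : right_inverse B3_one B3_inv B3_mul.
Proof.
move=> x; rewrite -(B3_ofW x) B3_invE B3_mulE.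
by apply/B3_ofP/word_mulV.
Qed.

HB.instance Definition _ :=
  isGroup.Build B3 B3_mulA B3_mul1 B3_mulr1 B3_mulV B3_mulrV.

Local Open Scope group_scope.

Definition sigma (i : 'I_2) : B3 := B3_of [:: (i, true)].

Definition word_eval (G : groupType) (g : 'I_2 -> G) (w : word) : G :=
  \prod_(l <- w) (if l.2 then g l.1 else (g l.1)^-1).

Definition represents (w : word) (x : B3) : Prop := word_eval sigma w = x.

Lemma word_eval_sigma w : word_eval sigma w = B3_of w.
Proof.
elim: w => [|[i b] w IHw]; rewrite /word_eval ?big_nil // big_cons.
rewrite -/(word_eval sigma w) IHw -cat1s -B3_mulE; congr (_ * _).
by case: b => //=; rewrite [LHS]B3_invE.
Qed.

(* Together with braid_relation and word_eval_sigma (the sigma i generate), this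
   is the universal property of the presentation, a check on the construction
   of B_3. *)
Lemma B3_universal (G : groupType) (g : 'I_2 -> G) :
    g s1 * g s2 * g s1 = g s2 * g s1 * g s2 ->
  exists f : B3 -> G,
    (forall x y, f (x * y) = f x * f y) /\ (forall i, f (sigma i) = g i).
Proof.
move=> brg.
have evcat v w : word_eval g (v ++ w) = word_eval g v * word_eval g w.
  by rewrite /word_eval big_cat.
have ev v w : braid_equiv v w -> word_eval g v = word_eval g w.
  elim=> {v w} //.
  - by move=> u v w _ -> _ ->.
  - by move=> v v' w w' _ ev_v _ ev_w; rewrite !evcat ev_v ev_w.
  - by case=> i []; rewrite /word_eval !big_cons !big_nil /= mulg1 ?mulgV ?mulVg.
  - by rewrite /word_eval !big_cons !big_nil /= !mulg1 !mulgA.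
exists (fun x => word_eval g (repr x)); split=> [x y|i].
  rewrite -evcat; apply: ev.
  exact: repr_B3_of.
rewrite (ev _ _ (repr_B3_of _)) /word_eval big_cons big_nil /=.
exact: mulg1.
Qed.

Lemma braid_relation : sigma s1 * sigma s2 * sigma s1
                     = sigma s2 * sigma s1 * sigma s2.
Proof.
rewrite /mul/= /sigma !B3_mulE; apply/B3_ofP.
exact: BraidRel.
Qed.

Definition occurs (i : 'I_2) (w : word) : bool :=
  ((i, true) \in w) || ((i, false) \in w).

(* No m is the main generator of the empty word. *)
Definition main_generator (w : word) (m : 'I_2) : Prop :=
  occurs m w /\ forall i : 'I_2, occurs i w -> (i <= m)%N.

Definition sigma_positive (w : word) : Prop :=
  exists m : 'I_2,
    main_generator w m /\ (m, true) \in w /\ (m, false) \notin w.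

Definition sigma_negative (w : word) : Prop :=
  exists m : 'I_2,
    main_generator w m /\ (m, false) \in w /\ (m, true) \notin w.

(* Main.v *)
(** Every 3-braid can be written [w * Delta^-d] with [w] a positive word. Since
    conjugation by [Delta] exchanges the two generators, the factors [Delta^-1]
    can be moved to the places where [w] alternates between [sigma_1] and
    [sigma_2]: there [sigma_1 * sigma_2] becomes
    [sigma_1 * Delta^-1 * sigma_1 = sigma_2^-1], and [sigma_2 * sigma_1] becomes
    [sigma_2 * Delta^-1 * sigma_2 = sigma_1^-1]. When [d] is at least the number
    of alternations, starting from a block of [sigma_1], all the positive
    [sigma_2] disappear. Otherwise, starting from a block of [sigma_2], all the
    negative [sigma_2] disappear, unless one meets a factor
    [sigma_2 * sigma_1 * sigma_2 = Delta], which makes [d] smaller. *)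
Require Import Defs.
From mathcomp Require Import all_boot.

Set Implicit Arguments.
Unset Strict Implicit.
Unset Printing Implicit Defensive.

Local Open Scope group_scope.

(** Unlike sigma-positivity, for [l] over [s2] this holds of 1, [sigma_1] and [sigma_1^-1], so
    expressions can be assembled factor by factor. *)
Definition sigma_free (l : letter) (x : B3) : Prop :=
  exists2 w : word, B3_of w = x & l \notin w.

Lemma B3_of_cat v w : B3_of (v ++ w) = B3_of v * B3_of w.
Proof. exact/esym/B3_mulE. Qed.

Lemma B3_of_letter i b :
  B3_of [:: (i, b)] = if b then sigma i else (sigma i)^-1.
Proof. by case: b => //; apply/esym/B3_invE. Qed.

Lemma sigma_free1 l : sigma_free l 1.
Proof. by exists [::]. Qed.

Lemma sigma_freeM l x y : sigma_free l x -> sigma_free l y -> sigma_free l (x * y).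
Proof.
move=> [v <- lv] [w <- lw]; exists (v ++ w); first exact: B3_of_cat.
by rewrite mem_cat negb_or lv.
Qed.

Lemma sigma_freeX l x n : sigma_free l x -> sigma_free l (x ^+ n).
Proof.
move=> lx; elim: n => [|n IHn]; first exact: sigma_free1.
by rewrite expgS; apply: sigma_freeM.
Qed.

Lemma sigma_free_letter l l' : l != l' -> sigma_free l (B3_of [:: l']).
Proof. by move=> ll'; exists [:: l']; rewrite ?inE. Qed.

Lemma sigma_free_gen l i : l != (i, true) -> sigma_free l (sigma i).
Proof. exact: sigma_free_letter. Qed.

Lemma sigma_free_genV l i : l != (i, false) -> sigma_free l (sigma i)^-1.
Proof. by rewrite -(B3_of_letter i false); apply: sigma_free_letter. Qed.

Lemma I2_cases (i : 'I_2) : i = s1 \/ i = s2.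
Proof.
case: i => [[|[|//]] lti]; first by left; apply: val_inj.
by right; apply: val_inj.
Qed.

Lemma sigma1_power w : ~~ occurs s2 w ->
  exists n b, B3_of w = B3_of (nseq n (s1, b)).
Proof.
elim: w => [_|[i b] w IHw]; first by exists 0, true.
rewrite /occurs !inE !negb_or -!andbA => /and4P[i2 w2 i2' w2'].
have {i2 i2'} -> : i = s1.
  by case: (I2_cases i) i2 i2' => // ->; case: b.
have [|n [b' wE]] := IHw; first by rewrite negb_or w2.
rewrite -cat1s B3_of_cat {}wE.
have [-> | bb'] := eqVneq b b'; first by exists n.+1, b'; rewrite -B3_of_cat.
case: n => [|n]; first by exists 1%N, b; rewrite -B3_of_cat.
exists n, b'; rewrite -[nseq n.+1 _]cat1s B3_of_cat mulgA !B3_of_letter.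
by case: b b' bb' => [] [] // _; rewrite ?mulgV ?mulVg mul1g.
Qed.

Definition sigma_definite (x : B3) : Prop :=
  exists w : word, represents w x /\ (sigma_positive w \/ sigma_negative w).

Lemma sigma_definite_main w m b : main_generator w m -> (m, b) \in w ->
  (m, ~~ b) \notin w -> sigma_definite (B3_of w).
Proof.
move=> wm mw mw'; exists w; split; first exact: word_eval_sigma.
by case: b mw mw'; [left | right]; exists m.
Qed.

(** A word avoiding [(s2, b)] either contains [s2], with the opposite sign only, or reduces to a
    power of [sigma_1], nonempty since [x] is nontrivial. *)
Lemma sigma_free_definite b x :
  sigma_free (s2, b) x -> x <> 1 -> sigma_definite x.
Proof.
case=> w <- w2b w_n1.
have [w2 | w2] := boolP (occurs s2 w).
  apply: (@sigma_definite_main _ s2 (~~ b)); rewrite ?negbK //.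
    by split=> // i _; apply: leq_ord.
  by case: b w2b w2 => /negPf w2b; rewrite /occurs w2b ?orbF.
have [[|n] [b' wE]] := sigma1_power w2; first by rewrite wE in w_n1.
rewrite wE; apply: (@sigma_definite_main _ s1 b').
- split; first by case: b' {wE}; rewrite /occurs !mem_nseq eqxx ?orbT.
  by move=> i; rewrite /occurs !mem_nseq !xpair_eqE; case: (I2_cases i) => ->.
- by rewrite mem_nseq eqxx.
- by rewrite mem_nseq xpair_eqE; case: b' {wE}.
Qed.

(* Positive words are encoded as boolean sequences: [true] is sigma_2, [false]
   is sigma_1, so that conjugation by Delta is [map negb]. *)
Definition gen (c : bool) : B3 := sigma (if c then s2 else s1).

Definition Delta : B3 := gen false * gen true * gen false.

Definition pos_eval (w : seq bool) : B3 := \prod_(c <- w) gen c.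

(** [c] is the letter preceding [w]; thus [alternations false w] counts a leading [sigma_2] as a
    change from an empty block of [sigma_1]. *)
Fixpoint alternations (c : bool) (w : seq bool) : nat :=
  if w is c' :: w' then (c != c') + alternations c' w' else 0.

Lemma DeltaE c : Delta = gen c * gen (~~ c) * gen c.
Proof. by case: c => //; apply: braid_relation. Qed.

Lemma gen_Delta c : gen c * Delta = Delta * gen (~~ c).
Proof. by rewrite {1}(DeltaE (~~ c)) (DeltaE c) negbK !mulgA. Qed.

Lemma DeltaV_gen c : Delta^-1 * gen c = gen (~~ c) * Delta^-1.
Proof.
by apply: (mulgI Delta); rewrite mulVKg mulgA -gen_Delta mulgK.
Qed.

Lemma gen_DeltaV_gen c x :
  gen c * (Delta^-1 * (gen c * x)) = (gen (~~ c))^-1 * x.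
Proof. by rewrite (DeltaE c) !invgM -!mulgA mulKg mulVKg. Qed.

Lemma pos_eval_cons c w : pos_eval (c :: w) = gen c * pos_eval w.
Proof. exact: big_cons. Qed.

Lemma DeltaV_pos_eval w :
  Delta^-1 * pos_eval w = pos_eval (map negb w) * Delta^-1.
Proof.
elim: w => [|c w IHw]; first by rewrite /pos_eval !big_nil mulg1 mul1g.
by rewrite /= !pos_eval_cons mulgA DeltaV_gen -mulgA IHw mulgA.
Qed.

Lemma pos_eval_DeltaVS w d : pos_eval w * Delta^-1 ^+ d.+1 =
  Delta^-1 * (pos_eval (map negb w) * Delta^-1 ^+ d).
Proof.
by rewrite mulgA DeltaV_pos_eval (mapK negbK) -mulgA -expgS.
Qed.

Lemma alternations_negb c w :
  alternations (~~ c) (map negb w) = alternations c w.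
Proof.
by elim: w c => //= c' w IHw c; rewrite IHw (inj_eq negb_inj).
Qed.

Lemma sigma_free_pos_eval i w : sigma_free (i, false) (pos_eval w).
Proof.
elim: w => [|c w IHw]; first by rewrite /pos_eval big_nil; apply: sigma_free1.
rewrite pos_eval_cons; apply: sigma_freeM IHw; apply: sigma_free_gen.
by rewrite xpair_eqE andbF.
Qed.

Lemma sigma_free_DeltaV i : sigma_free (i, true) Delta^-1.
Proof.
rewrite !invgM; do 2?apply: sigma_freeM;
  by apply: sigma_free_genV; rewrite xpair_eqE andbF.
Qed.

(** At a leading [sigma_2], one [Delta^-1] is pulled to the front: the flipped word starts with
    [sigma_1] and has one alternation fewer. Surplus factors [Delta^-1] contain no positive
    letter. *)
Lemma few_alternations w d : alternations false w <= d ->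
  sigma_free (s2, true) (pos_eval w * Delta^-1 ^+ d).
Proof.
have s1_free : sigma_free (s2, true) (gen false) by apply: sigma_free_gen.
have [n] := ubnP (size w); elim: n w d => // n IHn [|[] w] d.
- move=> _ _; rewrite /pos_eval big_nil mul1g.
  exact/sigma_freeX/sigma_free_DeltaV.
- case: d => // d ltwn lewd; rewrite pos_eval_DeltaVS /= pos_eval_cons -mulgA.
  apply: sigma_freeM (sigma_free_DeltaV _) (sigma_freeM s1_free _).
  by apply: IHn; rewrite ?size_map // (alternations_negb true).
- move=> ltwn lewd; rewrite pos_eval_cons -mulgA.
  by apply: sigma_freeM s1_free _; apply: IHn.
Qed.

Definition reducible (d : nat) (x : B3) : Prop :=
  exists w e, e < d /\ x = pos_eval w * Delta^-1 ^+ e.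

Lemma reducible_gen c d x : reducible d x -> reducible d (gen c * x).
Proof.
case=> w [e [lted ->]]; exists (c :: w), e; split=> //.
by rewrite pos_eval_cons mulgA.
Qed.

Lemma reducible_DeltaV d x : reducible d x -> reducible d.+1 (Delta^-1 * x).
Proof.
case=> w [e [lted ->]]; exists (map negb w), e.+1; split=> //.
by rewrite pos_eval_DeltaVS (mapK negbK).
Qed.

Lemma many_alternations_s2 w d : d <= alternations true w ->
  let x := pos_eval (true :: w) * Delta^-1 ^+ d in
  sigma_free (s2, false) x \/ reducible d x.
Proof.
have [n] := ubnP (size w); elim: n w d => // n IHn [|c w] d ltwn.
  rewrite leqn0 => /eqP-> /=; left; rewrite mulg1.
  exact: sigma_free_pos_eval.
case: c ltwn => ltwn lewd /=; rewrite pos_eval_cons -mulgA.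
  have [x_free | x_red] := IHn w d ltwn lewd.
    by left; apply: sigma_freeM x_free; apply: sigma_free_gen.
  by right; apply: reducible_gen.
case: d lewd => [_|d lewd].
  by left; rewrite mulg1 -pos_eval_cons; apply: sigma_free_pos_eval.
rewrite pos_eval_DeltaVS /=.
case: w ltwn lewd => [|[] w] ltwn lewd /=.
(* A single alternation is left, so [d] is 0 and the element is [sigma_1^-1]. *)
- left; case: d lewd => // _; rewrite pos_eval_cons -mulgA gen_DeltaV_gen.
  rewrite /pos_eval big_nil !mulg1; exact: sigma_free_genV.
(* The word starts with [sigma_2 * sigma_1 * sigma_2 = Delta], which absorbs one [Delta^-1] and
   flips the rest. *)
- right; exists (map negb w), d; split=> //.
  by rewrite !pos_eval_cons -!mulgA gen_DeltaV_gen mulKg.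
(* The second [sigma_1] of the block is flipped to [sigma_2], from which the induction restarts. *)
- have -> : gen true *
      (Delta^-1 * (pos_eval [:: true, true & map negb w] * Delta^-1 ^+ d)) =
      (gen false)^-1 * (pos_eval (true :: map negb w) * Delta^-1 ^+ d).
    by rewrite pos_eval_cons -!mulgA gen_DeltaV_gen.
  have [| |x_free | x_red] := IHn (map negb w) d.
  + by rewrite size_map ltnW.
  + by rewrite (alternations_negb false).
  + by left; apply: sigma_freeM x_free; apply: sigma_free_genV.
  (* Unfolding [sigma_1^-1] as [sigma_2 * Delta^-1 * sigma_2] raises the bound only from [d] to
     [d.+1]. *)
  + right; rewrite -(gen_DeltaV_gen true).
    by apply/reducible_gen/reducible_DeltaV/reducible_gen.
Qed.

(** A leading block of [sigma_1] is harmless. At the first [sigma_2] the strict bound becomes a weak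
    one, since [alternations false] counts one change more there. *)
Lemma many_alternations w d : d < alternations false w ->
  let x := pos_eval w * Delta^-1 ^+ d in
  sigma_free (s2, false) x \/ reducible d x.
Proof.
elim: w => [|[] w IHw] // ltdw; first exact: many_alternations_s2.
rewrite /= pos_eval_cons -mulgA.
have [x_free | x_red] := IHw ltdw; last by right; apply: reducible_gen.
by left; apply: sigma_freeM x_free; apply: sigma_free_gen.
Qed.

Lemma pos_eval_sigma_free w d :
  exists b, sigma_free (s2, b) (pos_eval w * Delta^-1 ^+ d).
Proof.
elim/ltn_ind: d w => d IHd w.
have [lewd | ltdw] := leqP (alternations false w) d.
  by exists true; apply: few_alternations.
have [x_free | [w' [e [lted ->]]]] := many_alternations ltdw; last exact: IHd.
by exists false.
Qed.

Lemma pos_eval_surj x : exists w d, x = pos_eval w * Delta^-1 ^+ d.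
Proof.
rewrite -(B3_ofW x); elim: (repr x) => [|[i b] v [w [d IHv]]].
  by exists [::], 0; rewrite /pos_eval big_nil mulg1.
have [c gcE] : exists c, sigma i = gen c.
  by case: (I2_cases i) => ->; [exists false | exists true].
rewrite -cat1s B3_of_cat B3_of_letter {}IHv {}gcE; case: b.
  by exists (c :: w), d; rewrite pos_eval_cons mulgA.
(* Since [(gen c)^-1 = gen (~~ c) * Delta^-1 * gen (~~ c)], moving this [Delta^-1] to the right end
   flips the second letter and [w]. *)
exists [:: ~~ c, c & map negb w], d.+1.
rewrite pos_eval_cons -mulgA pos_eval_DeltaVS /= (mapK negbK) pos_eval_cons.
by rewrite -mulgA gen_DeltaV_gen negbK.
Qed.

Theorem proposition4p17 (x : B3) (hx : x <> 1%g) :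
  exists w : word, represents w x /\ (sigma_positive w \/ sigma_negative w).
Proof.
have [w [d xE]] := pos_eval_surj x.
have [b x_free] := pos_eval_sigma_free w d.
by apply: (sigma_free_definite (b := b)) hx; rewrite xE.
Qed.
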